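(* Let $(v_h^n)_{n=0}^N\subset X^h$, $(q_h^n)_{n=1}^N\subset Q^h$ satisfy the linearized backward Euler scheme: for $n=0,\dots,N-1$, all $w^h\in X^h$ and all $\lambda^h\in Q^h$, $$\Big(\frac{v_h^{n+1}-v_h^n}{\Delta t},w^h\Big)+\nu(\nabla v_h^{n+1},\nabla w^h)+b^*(v_h^n,v_h^{n+1},w^h)-\chi\big(I_H(u(t_{n+1}))-I_H(v_h^{n+1}),w^h\big)-(q_h^{n+1},\nabla\cdot w^h)=(f(t_{n+1}),w^h),$$ $$(\nabla\cdot v_h^{n+1},\lambda^h)-\mu_1(I_H(p(t_{n+1})-q_h^{n+1}),\lambda^h)-\mu_2(I_H(q_h^{n+1})-q_h^{n+1},\lambda^h)=0.$$ Assume $I_H$ is an $L^2$-projection. Then $$\|v_h^N\|^2-\|v_h^0\|^2+\sum_{n=0}^{N-1}\|v_h^{n+1}-v_h^n\|^2+\Delta t\sum_{n=0}^{N-1}\Big[\nu\|\nabla v_h^{n+1}\|^2+\chi\|I_H(v_h^{n+1})\|^2+\alpha_1\|q_h^{n+1}\|^2\Big]$$ $$\le \Delta t\sum_{n=0}^{N-1}\Big[\frac1\nu\|f(t_{n+1})\|_{-1}^2+\mu_1\|I_H(p(t_{n+1}))\|^2+\chi\|I_H(u(t_{n+1}))\|^2\Big],$$ where $\alpha_1=\min\{\mu_1,2\mu_2\}$.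
   Context: $\Omega\subset\mathbb{R}^d$, $d=2$ or $3$, is a domain; $\|\cdot\|$ and $(\cdot,\cdot)$ are the $L^2(\Omega)$ norm and inner product. $X=(H_0^1(\Omega))^d$, $Q=L_0^2(\Omega)$ (mean-zero $L^2$ functions), and $X^h\subset X$, $Q^h\subset Q$ are conforming finite element spaces. The dual norm is $\|f\|_{-1}=\sup_{0\ne v\in X}\langle f,v\rangle/\|\nabla v\|$. The skew-symmetrized trilinear form is $b^*(u,v,w)=\frac12(u\cdot\nabla v,w)-\frac12(u\cdot\nabla w,v)$. $\nu>0$ is the viscosity, $\chi>0$ the velocity nudging parameter, $\mu_1,\mu_2>0$ the pressure nudging parameters, $f$ the body force. $\Delta t>0$ is the time step, $t_n=n\Delta t$, $N=T/\Delta t$. $I_H$ is the observation operator of spatial resolution $H$, applied to both velocities (vector functions) and pressures (scalar functions); that it is an $L^2$-projection means it is the orthogonal projection in $L^2$ onto its range. $(u,p)$ is the reference velocity and pressure (a solution of the slightly compressible Navier--Stokes equations) whose observations are the given data. *)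

(* Defs.v *)
From HB Require Import structures.
From mathcomp Require Import all_boot all_order all_algebra.
From mathcomp Require Import all_classical all_reals all_analysis.
From mathcomp Require Import measurable_realfun.

Set Implicit Arguments.
Unset Strict Implicit.
Unset Printing Implicit Defensive.

Import Order.TTheory GRing.Theory Num.Theory.
Import numFieldNormedType.Exports.

Local Open Scope classical_set_scope.
Local Open Scope ring_scope.

Section borel_rV.
Context (R : realType) (n : nat).

Let borel := <<s [set A : set 'rV[R]_n | open A] >>.

Let borel0 : borel set0. Proof. exact: sigma_algebra0. Qed.

Let borelC A : borel A -> borel (~` A). Proof. exact: sigma_algebraC. Qed.

Let borel_bigcup (F : (set 'rV[R]_n)^nat) :
  (forall i, borel (F i)) -> borel (\bigcup_i (F i)).
Proof. exact: sigma_algebra_bigcup. Qed.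

HB.instance Definition _ := @isMeasurable.Build default_measure_display
  'rV[R]_n borel borel0 borelC borel_bigcup.

Lemma open_measurable_rV (A : set 'rV[R]_n) : open A -> measurable A.
Proof. by move=> oA; apply: sub_sigma_algebra. Qed.

Lemma measurable_fun_rV d (T : measurableType d) (f : T -> 'rV[R]_n) :
  (forall U : set 'rV[R]_n, open U -> measurable (f @^-1` U)) ->
  measurable_fun setT f.
Proof.
move=> mf; apply: (@measurability _ _ _ _ _ _ [set A : set 'rV[R]_n | open A]) => //.
by move=> _ [U oU <-]; rewrite setTI; exact: mf.
Qed.

Lemma open_rV_bigcup (U : set 'rV[R]_n) : open U ->
  U = \bigcup_(k in [set k : 'rV[rat]_n * nat |
        ball (map_mx ratr k.1 : 'rV[R]_n) k.2.+1%:R^-1 `<=` U])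
      ball (map_mx ratr k.1 : 'rV[R]_n) k.2.+1%:R^-1.
Proof.
move=> oU; apply/seteqP; split => [x Ux|x [k /= kU]]; last exact: kU.
have /nbhs_ballP[e /= e0 eU] := open_nbhs_nbhs (conj oU Ux).
have [m me] : exists m, m.+1%:R^-1 < e / 2 :> R.
  have e20 : 0 < e / 2 by rewrite divr_gt0.
  exists (Num.truncn (e / 2)^-1); rewrite invf_plt ?posrE//.
  by have := truncnS_gt (e / 2)^-1.
have m0 : 0 < m.+1%:R^-1 :> R by rewrite invr_gt0.
have q i : {q : rat | ratr q \in `](x ord0 i - m.+1%:R^-1), (x ord0 i + m.+1%:R^-1)[}.
  by apply/cid/rat_in_itvoo; rewrite ltrD2l (lt_trans _ m0)// oppr_lt0.
pose c := \row_i sval (q i).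
have cx : ball (map_mx ratr c : 'rV[R]_n) m.+1%:R^-1 x.
  split => // i j; rewrite ord1 /ball/= !mxE.
  by have := svalP (q j); rewrite in_itv/= -ltr_distl.
exists (c, m) => //= y cy; apply: eU.
apply: (@le_ball _ _ _ (m.+1%:R^-1 + m.+1%:R^-1)).
  by rewrite [leRHS]splitr lerD// ltW.
by apply: ball_triangle cy; exact: ball_sym.
Qed.

Lemma measurable_coord_rV (j : 'I_n) :
  measurable_fun setT (fun x : 'rV[R]_n => x ord0 j : measurableTypeR R).
Proof.
apply: (measurability _ (RGenOInfty.measurableE R)) => _ [_ [a ->] <-].
rewrite setTI; apply: open_measurable_rV.
apply: (@open_comp _ _ (fun x : 'rV[R]_n => x ord0 j)) => //.
by move=> x _; exact: coord_continuous.
Qed.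

Lemma measurable_box_rV (a b : 'I_n -> R) :
  measurable [set x : 'rV[R]_n | forall j, x ord0 j \in `[a j, b j]].
Proof.
rewrite (_ : mkset _ = \bigcap_(j in [set: 'I_n])
    (setT `&` (fun x : 'rV[R]_n => x ord0 j) @^-1` `[a j, b j])).
  apply: fin_bigcap_measurable => // j _.
  by apply: measurable_coord_rV => //; exact: measurable_itv.
by apply/seteqP; split => x /= h j => [_|]; [split => //; exact: h|apply: (h j I).2].
Qed.

End borel_rV.

Section lebesgue_rV_cons.
Context (R : realType) (n : nat) (mu : {sigma_finite_measure set 'rV[R]_n -> \bar R}).

Definition rV_cons (z : measurableTypeR R * 'rV[R]_n) : 'rV[R]_n.+1 :=
  \row_j oapp (z.2 ord0) z.1 (unlift ord0 j).

Definition rV_uncons (x : 'rV[R]_n.+1) : measurableTypeR R * 'rV[R]_n :=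
  (x ord0 ord0, \row_j x ord0 (lift ord0 j)).

Lemma rV_cons0 z : rV_cons z ord0 ord0 = z.1.
Proof. by rewrite mxE unlift_none. Qed.

Lemma rV_consS z j : rV_cons z ord0 (lift ord0 j) = z.2 ord0 j.
Proof. by rewrite mxE liftK. Qed.

Lemma rV_consK : cancel rV_cons rV_uncons.
Proof.
move=> z; rewrite /rV_uncons rV_cons0 [RHS]surjective_pairing; congr pair.
by apply/rowP => j; rewrite mxE rV_consS.
Qed.

Lemma measurable_rV_cons : measurable_fun setT rV_cons.
Proof.
apply: measurable_fun_rV => U /open_rV_bigcup ->.
rewrite preimage_bigcup bigcup_mkcond.
apply: countable_bigcupT_measurable => // -[c k] /=.
case: ifPn => // _; set x : 'rV[R]_n.+1 := map_mx _ _; set e := _^-1.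
have e0 : 0 < e by rewrite invr_gt0.
rewrite (_ : _ @^-1` _ = (ball (x ord0 ord0) e : set (measurableTypeR R)) `*`
    ball (\row_j x ord0 (lift ord0 j)) e).
  apply: measurableX; first by rewrite ball_itv; exact: measurable_itv.
  apply: open_measurable_rV; exact: ball_open.
apply/seteqP; split => z /=.
  move=> [_ xz]; split; first by have := xz ord0 ord0; rewrite rV_cons0.
  split => // i j; rewrite (ord1 i) mxE.
  by have := xz ord0 (lift ord0 j); rewrite rV_consS.
move=> [xz0 [_ xz]]; split => // i j; rewrite (ord1 i).
case: (unliftP ord0 j) => [j'|] -> {j}; last by rewrite rV_cons0.
by have := xz ord0 j'; rewrite mxE rV_consS.
Qed.

Lemma measurable_rV_uncons : measurable_fun setT rV_uncons.
Proof.
apply/measurable_fun_pairP; split.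
  exact: measurable_coord_rV.
apply: measurable_fun_rV => U oU; apply: open_measurable_rV.
apply: (@open_comp _ _ (fun x : 'rV[R]_n.+1 => \row_j x ord0 (lift ord0 j) : 'rV_n)) => //.
move=> x _ A /nbhs_ballP[e e0 eA]; apply/nbhs_ballP; exists e => // y [_ xy].
by apply: eA; split => // i j; rewrite !mxE.
Qed.

Lemma rV_uncons_consK : cancel rV_uncons rV_cons.
Proof.
move=> x; apply/rowP => j; case: (unliftP ord0 j) => [j'|] ->.
  by rewrite rV_consS mxE.
by rewrite rV_cons0.
Qed.

Definition lebesgue_rV_cons (A : set 'rV[R]_n.+1) : \bar R :=
  pushforward (@lebesgue_measure R \x mu)%E rV_cons A.

Let lebesgue_rV_cons0 : lebesgue_rV_cons set0 = 0%E.
Proof. by rewrite /lebesgue_rV_cons/pushforward preimage_set0 measure0. Qed.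

Let lebesgue_rV_cons_ge0 A : (0 <= lebesgue_rV_cons A)%E.
Proof. exact: (measure_ge0 (@lebesgue_measure R \x mu)%E). Qed.

Let lebesgue_rV_cons_sigma_additive : semi_sigma_additive lebesgue_rV_cons.
Proof.
move=> F mF tF mUF.
rewrite /lebesgue_rV_cons /pushforward preimage_bigcup.
have mcons A : measurable A -> measurable (rV_cons @^-1` A).
  by move=> mA; rewrite -[X in measurable X]setTI; exact: measurable_rV_cons.
apply: (@measure_semi_sigma_additive _ _ _ (@lebesgue_measure R \x mu)%E).
- by move=> i; exact: mcons.
- apply/trivIsetP => i j _ _ ij; rewrite -preimage_setI.
  by move/trivIsetP : tF => /(_ _ _ _ _ ij) ->//; rewrite preimage_set0.
- by rewrite -preimage_bigcup; exact: mcons.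
Qed.

HB.instance Definition _ := isMeasure.Build _ _ _ lebesgue_rV_cons
  lebesgue_rV_cons0 lebesgue_rV_cons_ge0 lebesgue_rV_cons_sigma_additive.

Let lebesgue_rV_cons_sigma_finite : sigma_finite setT lebesgue_rV_cons.
Proof.
have /sigma_finiteP[F [TF ndF Foo]] := sigma_finiteT (@lebesgue_measure R).
have /sigma_finiteP[G [TG ndG Goo]] := sigma_finiteT mu.
exists (fun i => rV_uncons @^-1` (F i `*` G i)) => [|i].
  rewrite -preimage_bigcup -[LHS](preimage_setT rV_uncons); congr (_ @^-1` _).
  rewrite -setXTT TF TG; apply/seteqP; split => [[x y]|[x y]] /=.
    move=> [[i _ Fx] [j _ Gy]]; exists (maxn i j) => //; split => /=.
      by move: x Fx; exact/subsetPset/ndF/leq_maxl.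
    by move: y Gy; exact/subsetPset/ndG/leq_maxr.
  by move=> [i _ [? ?]]; split; exists i.
have [mF Fi] := Foo i; have [mG Gi] := Goo i; split.
  rewrite -[X in measurable X]setTI; apply: measurable_rV_uncons => //.
  exact: measurableX.
rewrite /lebesgue_rV_cons /pushforward (_ : _ @^-1` _ = F i `*` G i).
  by rewrite product_measure1E// lte_mul_pinfty// ge0_fin_numE.
by rewrite -comp_preimage (_ : rV_uncons \o rV_cons = id)//; exact/funext/rV_consK.
Qed.

HB.instance Definition _ := Measure_isSigmaFinite.Build _ _ _ lebesgue_rV_cons
  lebesgue_rV_cons_sigma_finite.

End lebesgue_rV_cons.

Fixpoint lebesgue_rV (R : realType) (n : nat) :
    {sigma_finite_measure set 'rV[R]_n -> \bar R} :=
  if n is n'.+1 then lebesgue_rV_cons (lebesgue_rV R n') else \d_(0 : 'rV[R]_0).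

Lemma lebesgue_rV_box (R : realType) (n : nat) (a b : 'I_n -> R) :
  (forall j, a j <= b j) ->
  lebesgue_rV R n [set x : 'rV[R]_n | forall j, x ord0 j \in `[a j, b j]] =
  (\prod_j (b j - a j))%:E.
Proof.
elim: n a b => [|n IH] a b ab.
  by rewrite big_ord0 /= diracE mem_set// => -[].
rewrite big_ord_recl EFinM -IH/= => [|j]; last exact: ab.
have <- : lebesgue_measure (`[a ord0, b ord0] : set (measurableTypeR R)) =
    (b ord0 - a ord0)%:E.
  by rewrite lebesgue_measure_itv/= lte_fin; case: ltgtP (ab ord0) => // -> _; rewrite subrr.
have mI : measurable (`[a ord0, b ord0] : set (measurableTypeR R)).
  exact: measurable_itv.
rewrite -(product_measure1E _ _ mI (measurable_box_rV _ _)).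
rewrite /lebesgue_rV_cons /pushforward; congr (_ _).
apply/seteqP; split => z /=.
  move=> h; split; first by have := h ord0; rewrite rV_cons0.
  by move=> j; have := h (lift ord0 j); rewrite rV_consS.
move=> [h0 h] j; case: (unliftP ord0 j) => [j'|] ->; first by rewrite rV_consS.
by rewrite rV_cons0.
Qed.

Record domain (R : realType) (d : nat) := Domain {
  dom :> set 'rV[R]_d;
  dom_open : open dom;
  dom_connected : connected dom;
  dom_nonempty : dom !=set0
}.

Definition vol (R : realType) (d : nat) (Om : domain R d) :
    {measure set 'rV[R]_d -> \bar R} :=
  mrestr (lebesgue_rV R d) (open_measurable_rV (@dom_open _ _ Om)).

(* Elements of [L2 Om] are functions on R^d rather than classes modulo
   almost-everywhere equality; as [vol Om] vanishes outside [Om], their values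
   there are irrelevant. Equality in L^2 is [eqL2]. *)
Notation L2 Om := (LfunType (vol Om) (lee1n 2)).

Section lebesgue_spaces.
Context (R : realType) (d : nat) (Om : domain R d).
Implicit Types (q r : L2 Om) (v w : 'I_d -> L2 Om) (G H : 'I_d -> 'I_d -> L2 Om).

Definition eqL2 q r : Prop := \forall x \ae vol Om, q x = r x.
Definition eqL2vec v w : Prop := forall i, eqL2 (v i) (w i).

Definition ip q r : R := \int[vol Om]_x (q x * r x).
Definition ipvec v w : R := \sum_i ip (v i) (w i).
Definition iptens G H : R := \sum_i \sum_j ip (G i j) (H i j).

Definition norm q : R := Num.sqrt (ip q q).
Definition normvec v : R := Num.sqrt (ipvec v v).
Definition normtens G : R := Num.sqrt (iptens G G).

End lebesgue_spaces.

Section sobolev.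
Context (R : realType) (d : nat) (Om : domain R d).

Definition partial (i : 'I_d) (phi : 'rV[R]_d -> R) : 'rV[R]_d -> R :=
  fun x => 'D_(delta_mx 0 i) phi x.

Fixpoint Ck (k : nat) (phi : 'rV[R]_d -> R) : Prop :=
  continuous phi /\
  (if k is k'.+1 then
     forall i, (forall x, derivable phi x (delta_mx 0 i)) /\ Ck k' (partial i phi)
   else True).

(* C_c^oo(Om), each function being extended by 0 to R^d. *)
Definition test_function (phi : 'rV[R]_d -> R) : Prop :=
  [/\ forall k, Ck k phi,
      compact (closure [set x | phi x != 0]) &
      closure [set x | phi x != 0] `<=` Om].

Definition is_weak_partial (i : 'I_d) (q g : L2 Om) : Prop :=
  forall phi, test_function phi ->
    \int[vol Om]_x (q x * partial i phi x) = - \int[vol Om]_x (g x * phi x).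

(* A weak derivative is unique up to almost-everywhere equality; 0 is a dummy
   value outside of H^1. *)
Definition weak_partial (i : 'I_d) (q : L2 Om) : L2 Om :=
  xget 0 [set g | is_weak_partial i q g].

Definition H1 : set (L2 Om) :=
  [set q | forall i, exists g, is_weak_partial i q g].

Definition H10 : set (L2 Om) :=
  [set q | H1 q /\ forall eps : R, 0 < eps -> exists2 phi, test_function phi &
    (\int[vol Om]_x ((q x - phi x) ^+ 2)%:E +
     \sum_i \int[vol Om]_x ((weak_partial i q x - partial i phi x) ^+ 2)%:E
     < eps%:E)%E].

Definition X : set ('I_d -> L2 Om) := [set v | forall i, H10 (v i)].

(* The integral is extended-real valued: when [Om] has infinite measure, the
   condition includes the integrability of [q]. *)
Definition Q : set (L2 Om) := [set q | (\int[vol Om]_x (q x)%:E = 0)%E].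

Definition grad (v : 'I_d -> L2 Om) : 'I_d -> 'I_d -> L2 Om :=
  fun i j => weak_partial j (v i).

Definition div (v : 'I_d -> L2 Om) : L2 Om := \sum_i weak_partial i (v i).

(* ((u . nabla) v, w) *)
Definition convection (u v w : 'I_d -> L2 Om) : R :=
  \int[vol Om]_x (\sum_i (\sum_j u j x * grad v i j x) * w i x).

Definition bstar (u v w : 'I_d -> L2 Om) : R :=
  2^-1 * convection u v w - 2^-1 * convection u w v.

(* Linear functionals on the space X (not on its representatives, whence the
   second condition). They are not assumed to be bounded: [dual_norm] is +oo on
   the unbounded ones. *)
Definition X_functional (F : ('I_d -> L2 Om) -> R) : Prop :=
  (forall a v w, X v -> X w -> F (a *: v + w) = a * F v + F w) /\
  (forall v w, X v -> X w -> eqL2vec v w -> F v = F w).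

(* The denominator is nonzero: the gradient is injective on X. *)
Definition dual_norm (F : ('I_d -> L2 Om) -> R) : \bar R :=
  ereal_sup [set ((F v)%:E / (normtens (grad v))%:E)%E |
             v in [set v | X v /\ ~ eqL2vec v 0]].

End sobolev.

Section subspaces.
Context (R : realType) (V : lmodType R).

Definition linear_subspace (S : set V) : Prop :=
  S 0 /\ forall a v w, S v -> S w -> S (a *: v + w).

Definition finite_dim_subspace (S : set V) : Prop :=
  exists n (e : 'I_n -> V), S = [set v | exists c, v = \sum_i c i *: e i].

(* [P] is the orthogonal projection onto its range, where [ipV] is an inner
   product on [V] modulo the equivalence [eqV]. *)
Definition orthogonal_projection (eqV : V -> V -> Prop) (ipV : V -> V -> R)
    (P : V -> V) : Prop :=
  let range := [set w | exists v, eqV w (P v)] in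
  linear_subspace range /\
  forall v w, range w -> ipV (v - P v) w = 0.

End subspaces.

Section L2_functional.
Context (R : realType) (d : nat) (Om : domain R d).

Lemma integrable_mul (q r : L2 Om) :
  (vol Om).-integrable setT (fun x => (q x * r x)%:E).
Proof. by apply/Lfun1_integrable/Lfun2_mul_Lfun1; exact: LfunP. Qed.

Lemma ip_linear (g : L2 Om) a q r : ip g (a *: q + r) = a * ip g q + ip g r.
Proof.
rewrite /ip -RintegralZl//; last exact: integrable_mul.
rewrite -RintegralD//; last exact: integrable_mul.
  by apply: eq_Rintegral => x _ /=; rewrite mulrDr mulrCA.
have := integrableZl measurableT a (integrable_mul g q).
by apply: eq_integrable.
Qed.

(* A square-integrable body force g, acting as v |-> (g, v). *)
Lemma ipvec_X_functional (g : 'I_d -> L2 Om) : X_functional (ipvec g).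
Proof.
split => [a v w _ _|v w _ _ vw].
  by rewrite /ipvec mulr_sumr -big_split/=; apply: eq_bigr => i _; exact: ip_linear.
apply: eq_bigr => i _; rewrite /ip /Rintegral; congr fine.
apply: ae_eq_integral => //.
- by case/integrableP: (integrable_mul (g i) (v i)).
- by case/integrableP: (integrable_mul (g i) (w i)).
- by apply: filterS (vw i) => x -> _.
Qed.

End L2_functional.

(* Main.v *)
(** Test the momentum equation with [v n.+1] and the continuity equation with
    [q n.+1]: the convective term cancels by skew-symmetry, the time difference
    telescopes by polarization, and the orthogonality of the two projections
    turns the nudging terms into squares of norms. Young's inequality absorbs
    the data, and [min mu1 (2 * mu2)] comes from the Pythagorean splitting
    [|q|^2 = |I q|^2 + |q - I q|^2]. *)
Require Import Defs.
From mathcomp Require Import all_boot all_order all_algebra.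
From mathcomp Require Import all_classical all_reals all_analysis.
From mathcomp Require Import ring lra.

Import Order.TTheory GRing.Theory Num.Theory.
Import numFieldNormedType.Exports.

Local Open Scope classical_set_scope.
Local Open Scope ring_scope.

(** Definiteness is left out because vectors are functions, on which [ip] vanishes for null sets of
    difference. The same theory then serves [ip] and [ipvec]. *)
Definition semi_inner_product {R : realType} {V : lmodType R}
    (B : V -> V -> R) : Prop :=
  [/\ forall x y, B x y = B y x,
      forall z a x y, B z (a *: x + y) = a * B z x + B z y &
      forall x, 0 <= B x x].

Section semi_inner_product_theory.
Context {R : realType} {V : lmodType R} {B : V -> V -> R}.
Hypothesis hB : semi_inner_product B.

Lemma sipC x y : B x y = B y x. Proof. by case: hB. Qed.

Lemma sip_ge0 x : 0 <= B x x. Proof. by case: hB. Qed.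

Lemma sipDr z x y : B z (x + y) = B z x + B z y.
Proof. by case: hB => _ + _ => /(_ z 1 x y); rewrite scale1r mul1r. Qed.

Lemma sip0r z : B z 0 = 0.
Proof. by have := sipDr z 0 0; rewrite addr0; lra. Qed.

Lemma sipZr z a x : B z (a *: x) = a * B z x.
Proof. by case: hB => _ + _ => /(_ z a x 0); rewrite sip0r !addr0. Qed.

Lemma sipBr z x y : B z (x - y) = B z x - B z y.
Proof. by rewrite sipDr -scaleN1r sipZr mulN1r. Qed.

Lemma sipZl z a x : B (a *: x) z = a * B x z.
Proof. by rewrite sipC sipZr sipC. Qed.

Lemma sipBl z x y : B (x - y) z = B x z - B y z.
Proof. by rewrite sipC sipBr !(sipC z). Qed.

(** With [x] the new and [y] the old velocity, this yields the telescoping difference and the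
    numerical dissipation. *)
Lemma sip_polarization x y :
  2 * B (x - y) x = B x x - B y y + B (x - y) (x - y).
Proof. by rewrite !sipBl !sipBr (sipC y x); ring. Qed.

Lemma sip_young x y : 2 * B x y <= B x x + B y y.
Proof. by have := sip_ge0 (x - y); rewrite !sipBl !sipBr (sipC y x); lra. Qed.

Context {E : V -> V -> Prop} {P : V -> V}.
Hypotheses (Exx : forall x, E x x) (hP : orthogonal_projection E B P).

Let range := [set w | exists v, E w (P v)].

Let range_proj x : range (P x). Proof. by exists x; exact: Exx. Qed.

Let range_lin a x y : range x -> range y -> range (a *: x + y).
Proof. by case: hP => -[_ + _]; apply. Qed.

Let proj_orth x w : range w -> B w (x - P x) = 0.
Proof. by move=> rw; rewrite sipC; case: hP => _ ->. Qed.

(** [P x] lies in the range, to which [y - P y] is orthogonal. *)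
Lemma sip_proj x y : B (P x) y = B (P x) (P y).
Proof. by apply/eqP; rewrite -subr_eq0 -sipBr proj_orth. Qed.

(* [P] is linear only modulo [E], but no vector sees the defect. *)
Lemma sip_projB x y z : B (P (x - y)) z = B (P x - P y) z.
Proof.
apply/eqP; rewrite -subr_eq0 -sipBl; set D := P (x - y) - _.
have rD : range D.
  rewrite (_ : D = (-1) *: (P x - P y) + P (x - y)); last first.
    by rewrite scaleN1r addrC.
  apply: range_lin => //; rewrite addrC -scaleN1r; exact: range_lin.
(* As [D] lies in the range, only [P z] matters; against [P z] each projection in [D] may be
   replaced by its argument, and these cancel. *)
have -> : B D z = B D (P z) by apply/eqP; rewrite -subr_eq0 -sipBr proj_orth.
by rewrite sipC /D !sipBr -!sip_proj !sipBr subrr.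
Qed.

End semi_inner_product_theory.

Section L2_semi_inner_products.
Context {R : realType} {d : nat} {Om : domain R d}.

Lemma ip_semi_inner_product : semi_inner_product (@ip R d Om).
Proof.
split => [q r|g a q r|q]; last by apply: Rintegral_ge0 => x _; exact: sqr_ge0.
  by apply: eq_Rintegral => x _; rewrite mulrC.
exact: ip_linear.
Qed.

Lemma ipvec_semi_inner_product : semi_inner_product (@ipvec R d Om).
Proof.
split => [v w|u a v w|v].
- by apply: eq_bigr => i _; exact: (sipC ip_semi_inner_product).
- rewrite /ipvec mulr_sumr -big_split.
  by apply: eq_bigr => i _; exact: ip_linear.
- by apply: sumr_ge0 => i _; exact: (sip_ge0 ip_semi_inner_product).
Qed.

Lemma norm_sqr (q : L2 Om) : norm q ^+ 2 = ip q q.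
Proof. by rewrite sqr_sqrtr// (sip_ge0 ip_semi_inner_product). Qed.

Lemma normvec_sqr (v : 'I_d -> L2 Om) : normvec v ^+ 2 = ipvec v v.
Proof. by rewrite sqr_sqrtr// (sip_ge0 ipvec_semi_inner_product). Qed.

Lemma normtens_sqr (G : 'I_d -> 'I_d -> L2 Om) : normtens G ^+ 2 = iptens G G.
Proof.
rewrite sqr_sqrtr//; apply: sumr_ge0 => i _; apply: sumr_ge0 => j _.
exact: (sip_ge0 ip_semi_inner_product).
Qed.

Lemma eqL2_refl (q : L2 Om) : eqL2 q q. Proof. exact: nearW. Qed.

Lemma eqL2vec_refl (v : 'I_d -> L2 Om) : eqL2vec v v.
Proof. by move=> i; exact: eqL2_refl. Qed.

(** The two halves coincide, so convection contributes no energy even though the advecting field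
    need not be divergence free. *)
Lemma bstar_diag (u v : 'I_d -> L2 Om) : bstar u v v = 0.
Proof. exact: subrr. Qed.

Lemma sqre_ge0 (x : \bar R) : (0 <= x ^+ 2)%E.
Proof.
rewrite expe2; have [x0|x0] := leP 0%E x; first exact: mule_ge0.
by rewrite mule_le0 // ltW.
Qed.

(* If [grad v = 0] while [F v > 0], the quotient defining [dual_norm F] is
   [+oo], so that no Poincare inequality is needed. *)
Lemma dual_norm_young {F : ('I_d -> L2 Om) -> R} {nu : R} {v : 'I_d -> L2 Om} :
  X_functional F -> 0 < nu -> @X R d Om 0 -> X v ->
  ((2 * F v)%:E <=
   nu^-1%:E * dual_norm F ^+ 2 + (nu * normtens (grad v) ^+ 2)%:E)%E.
Proof.
move=> [Flin Fae] nu0 X0 Xv; set g := normtens (grad v).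
have g0 : 0 <= g by exact: sqrtr_ge0.
have nuV0 : 0 < nu^-1 by rewrite invr_gt0.
have [Fv_le0|Fv0] := leP (F v) 0.
  apply: (@le_trans _ _ 0%E); first by rewrite lee_fin; lra.
  apply: adde_ge0; last by rewrite lee_fin mulr_ge0 ?sqr_ge0// ltW.
  by apply: mule_ge0; [rewrite lee_fin ltW|exact: sqre_ge0].
(* [F] respects almost-everywhere equality and [F 0 = 0], so [F v > 0] makes [v] admissible in the
   supremum. *)
have v_neq0 : ~ eqL2vec v 0.
  move=> /(Fae _ _ Xv X0) Fv; have := Flin (-1) v v Xv Xv.
  by rewrite scaleN1r addNr -Fv; lra.
have : ((F v)%:E / g%:E <= dual_norm F)%E by apply: ereal_sup_ubound; exists v.
case: (dual_norm F) => [D| |].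
- rewrite inver; case: eqP => [_|/eqP gneq0]; first by rewrite gt0_muley ?lte_fin.
  have gt0 : 0 < g by rewrite lt_def gneq0.
  rewrite -EFinM lee_fin ler_pdivrMr// => FDg.
  rewrite expe2 -!EFinM -EFinD lee_fin.
  (* Young's inequality with weight [nu]: this square bounds [2 * (D * g)], which dominates
     [2 * F v]. *)
  have := mulr_ge0 (ltW nuV0) (sqr_ge0 (D - nu * g)).
  have -> : nu^-1 * (D - nu * g) ^+ 2 = nu^-1 * (D * D) + nu * g ^+ 2 - 2 * (D * g).
    by field; rewrite gt_eqF.
  lra.
- by move=> _; rewrite expe2 mulyy gt0_muley ?lte_fin// addye ?leey.
(* The value [-oo] is impossible: [v] contributes a nonnegative quotient. *)
- rewrite leeNy_eq => /eqP quot; have : (0 <= (F v)%:E / g%:E)%E.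
    by rewrite mule_ge0 ?inve_ge0 ?lee_fin// ltW.
  by rewrite quot.
Qed.

End L2_semi_inner_products.

Theorem theorem2p2 (R : realType) (d : nat) (hd : d = 2%N \/ d = 3%N)
    (Om : domain R d)
    (nu chi mu1 mu2 dt T : R)
    (nu_gt0 : 0 < nu) (chi_gt0 : 0 < chi)
    (mu1_gt0 : 0 < mu1) (mu2_gt0 : 0 < mu2) (dt_gt0 : 0 < dt)
    (N : nat) (NE : N%:R = T / dt)
    (Xh : set ('I_d -> L2 Om)) (Qh : set (L2 Om))
    (Xh_fin : finite_dim_subspace Xh) (Qh_fin : finite_dim_subspace Qh)
    (Xh_conforming : Xh `<=` @X R d Om) (Qh_conforming : Qh `<=` @Q R d Om)
    (IHv : ('I_d -> L2 Om) -> ('I_d -> L2 Om)) (IHp : L2 Om -> L2 Om)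
    (IHv_proj : orthogonal_projection (@eqL2vec R d Om) (@ipvec R d Om) IHv)
    (IHp_proj : orthogonal_projection (@eqL2 R d Om) (@ip R d Om) IHp)
    (u : R -> 'I_d -> L2 Om) (p : R -> L2 Om)
    (f : R -> ('I_d -> L2 Om) -> R)
    (f_dual : forall s, 0 < s <= T -> X_functional (f s))
    (v : nat -> 'I_d -> L2 Om) (q : nat -> L2 Om)
    (v_Xh : forall n, (n <= N)%N -> Xh (v n))
    (q_Qh : forall n, (0 < n <= N)%N -> Qh (q n)) :
  let t (n : nat) : R := n%:R * dt in
  (forall n, (n < N)%N ->
     (forall w, Xh w ->
        ipvec (dt^-1 *: (v n.+1 - v n)) w
        + nu * iptens (grad (v n.+1)) (grad w)
        + bstar (v n) (v n.+1) w
        - chi * ipvec (IHv (u (t n.+1)) - IHv (v n.+1)) w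
        - ip (q n.+1) (div w)
        = f (t n.+1) w) /\
     (forall l, Qh l ->
        ip (div (v n.+1)) l
        - mu1 * ip (IHp (p (t n.+1) - q n.+1)) l
        - mu2 * ip (IHp (q n.+1) - q n.+1) l
        = 0)) ->
  let alpha1 := Num.min mu1 (2 * mu2) in
  ((normvec (v N) ^+ 2 - normvec (v 0%N) ^+ 2
    + \sum_(n < N) normvec (v n.+1 - v n) ^+ 2
    + dt * \sum_(n < N) (nu * normtens (grad (v n.+1)) ^+ 2
                         + chi * normvec (IHv (v n.+1)) ^+ 2
                         + alpha1 * norm (q n.+1) ^+ 2))%:E
   <= dt%:E * \sum_(n < N) ((nu^-1)%:E * dual_norm (f (t n.+1)) ^+ 2
                            + (mu1 * norm (IHp (p (t n.+1))) ^+ 2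
                               + chi * normvec (IHv (u (t n.+1))) ^+ 2)%:E))%E.

Proof.
move=> t scheme; set alpha1 := Num.min _ _; cbv zeta.
have TE : T = N%:R * dt by rewrite NE divfK// gt_eqF.
have Xh0 : Xh 0.
  have [m [e ->]] := Xh_fin; exists (fun=> 0).
  by rewrite big1// => i _; rewrite scale0r.
(* Membership of 0 in [X] is inherited from [Xh] by conformity. *)
have X0 : @X R d Om 0 by exact: Xh_conforming.
have hv := @ipvec_semi_inner_product R d Om.
have hp := @ip_semi_inner_product R d Om.
have step (n : 'I_N) :
    ((normvec (v n.+1) ^+ 2 - normvec (v n) ^+ 2 + normvec (v n.+1 - v n) ^+ 2
      + dt * (nu * normtens (grad (v n.+1)) ^+ 2
              + chi * normvec (IHv (v n.+1)) ^+ 2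
              + alpha1 * norm (q n.+1) ^+ 2))%:E
     <= dt%:E * (nu^-1%:E * dual_norm (f (t n.+1)) ^+ 2
                 + (mu1 * norm (IHp (p (t n.+1))) ^+ 2
                    + chi * normvec (IHv (u (t n.+1))) ^+ 2)%:E))%E.
  have [mom cont] := scheme n (ltn_ord n).
  have vS : Xh (v n.+1) by exact: v_Xh.
  have := mom _ vS; have := cont _ (q_Qh n.+1 (ltn_ord n)).
  have tn : 0 < t n.+1 <= T.
    by rewrite /t mulr_gt0//= TE ler_pM2r// ler_nat.
  have := dual_norm_young (f_dual _ tn) nu_gt0 X0 (Xh_conforming _ vS).
  set F := f _ _; set D := (_ * dual_norm _ ^+ 2)%E => FD contE momE.
  set S := mu1 * _ + _.
  (* Only the forcing bound involves a possibly infinite quantity; the rest is real. Doubling the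
     momentum equation gives twice the viscous term, and one copy is spent on the forcing. *)
  suff real_step : normvec (v n.+1) ^+ 2 - normvec (v n) ^+ 2
      + normvec (v n.+1 - v n) ^+ 2
      + dt * (nu * normtens (grad (v n.+1)) ^+ 2
              + chi * normvec (IHv (v n.+1)) ^+ 2
              + alpha1 * norm (q n.+1) ^+ 2)
      <= dt * (2 * F - nu * normtens (grad (v n.+1)) ^+ 2 + S).
    apply: (@le_trans _ _
      (dt * (2 * F - nu * normtens (grad (v n.+1)) ^+ 2 + S))%:E) => //.
    by rewrite EFinM lee_pmul2l// EFinD leeD2r// EFinB leeBlDr.
  rewrite /S !normvec_sqr !norm_sqr -(sip_polarization hv).
  (* Inserting [dt * dt^-1] recovers the difference quotient of the scheme and lets the factor [dt]
     cancel. *)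
  rewrite -[X in 2 * X](mulVKf (lt0r_neq0 dt_gt0)) -(sipZl hv) mulrCA -mulrDr.
  rewrite ler_pM2l// normtens_sqr.
  move: momE contE; rewrite bstar_diag (sipC hp (div _)).
  rewrite (sip_projB hp eqL2_refl IHp_proj) !(sipBl hp).
  rewrite [ipvec (IHv _ - _) _](sipBl hv).
  set q1 := q n.+1; set v1 := v n.+1; set Iu := IHv _; set Ip := IHp _.
  rewrite !(sip_proj hv eqL2vec_refl IHv_proj _ v1).
  rewrite !(sip_proj hp eqL2_refl IHp_proj _ q1).
  have := sip_young hv Iu (IHv v1); have := sip_young hp Ip (IHp q1).
  have := sip_ge0 hp (q1 - IHp q1).
  rewrite (sipBl hp) !(sipBr hp) (sipC hp q1 (IHp q1)).
  rewrite !(sip_proj hp eqL2_refl IHp_proj _ q1).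
  have := sip_ge0 hp (IHp q1).
  set a := ip (IHp q1) _; set b := ip q1 q1.
  have a1 : alpha1 <= mu1 by rewrite /alpha1 ge_min lexx.
  have a2 : alpha1 <= 2 * mu2 by rewrite /alpha1 ge_min lexx orbT.
  move=> a0 ab yp yv momE contE.
  have ba : 0 <= b - a by lra.
  (* Here [a] is the squared norm of [IHp q1] and [b - a] that of [q1 - IHp q1], so [alpha1 * b <=
     mu1 * a + 2 * mu2 * (b - a)]. *)
  have := ler_wpM2r a0 a1; have := ler_wpM2r ba a2.
  have := ler_wpM2l (ltW mu1_gt0) yp; have := ler_wpM2l (ltW chi_gt0) yv.
  lra.
(* Terms may be [+oo], so [dt] is distributed over the sum by nonnegativity. *)
rewrite ge0_sume_distrr; last first.
  move=> n _; apply: adde_ge0.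
    by apply: mule_ge0; [rewrite lee_fin invr_ge0 ltW|exact: sqre_ge0].
  by rewrite lee_fin addr_ge0// mulr_ge0 ?sqr_ge0// ltW.
apply: le_trans (lee_sum _ (fun n _ => step n)).
rewrite sumEFin lee_fin [leRHS]big_split [X in _ <= X + _]big_split /=.
rewrite -[X in _ <= _ + X]mulr_sumr.
pose e n := normvec (v n) ^+ 2.
by rewrite -(big_mkord xpredT (fun n => e n.+1 - e n)) telescope_sumr.
Qed.
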